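(* For a parameter $k$, say that a triple of functions $(p(x),q(x),r(x))$ satisfies the system $S_k$ if $$\frac{dp}{dx}=\frac16(p^2-q),\qquad \frac{dq}{dx}=\frac23(pq-r),\qquad \frac{dr}{dx}=pr+\frac{k^2}{36-k^2}q^2 .$$ Thus in $S_{3/2}$ the last equation is $\frac{dr}{dx}=pr+\frac1{15}q^2$, and in $S_3$ it is $\frac{dr}{dx}=pr+\frac13q^2$. (i) Suppose $(P(x),Q(x),R(x))$ satisfies $S_{3/2}$. Let $$Z=\frac{3R}{2Q}+\frac12\sqrt{-\frac35Q},\qquad \bar Z=\frac{3R}{2Q}-\frac12\sqrt{-\frac35Q}.$$ Then the triples $$(p_2,q_2,r_2)=\left(P+Z,\ -\frac53\bar Z^2,\ \frac59\bar Z^2(2Z-\bar Z)\right),\qquad (p_3,q_3,r_3)=\left(P+\bar Z,\ -\frac53Z^2,\ \frac59Z^2(2\bar Z-Z)\right)$$ also satisfy $S_{3/2}$, while the triple $$(p_0,q_0,r_0)=\left(P+\frac RQ,\ \frac35Q-3\frac{R^2}{Q^2},\ \frac95R+3\frac{R^3}{Q^3}\right),$$ whose first entry is $p_0=\frac13(p_1+p_2+p_3)$ with $p_1=P$, satisfies $S_3$. In this case $y=p_0$ satisfies the generalised Chazy equation with parameter $k=3$, $$y'''-2yy''+3(y')^2-\frac{4}{36-3^2}(6y'-y^2)^2=0.$$ (ii) Conversely, given a triple $(p_0,q_0,r_0)$ that satisfies $S_3$, the triple $(P,Q,R)$ defined by $$P=p_0-\frac{r_0}{4z-q_0},\qquad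 Q=\frac53z,\qquad R=\frac53\frac{r_0z}{4z-q_0},$$ where $z$ is a root of the cubic equation $$16z^3-24q_0z^2+9q_0^2z-q_0^3-3r_0^2=0,$$ satisfies $S_{3/2}$.
   Context: Conventions: all functions are holomorphic functions of a complex variable $x$ on a connected open set, and $'$ denotes $\frac{d}{dx}$. In (i), $Q$ does not vanish on this set and a holomorphic branch of $\sqrt{-\frac35Q}$ is fixed, the same one being used in $Z$ and $\bar Z$; $\bar Z$ is just a name for the second function and does not denote complex conjugation. In (ii), $z=z(x)$ is a holomorphic function satisfying the cubic equation identically in $x$, with $4z-q_0$ nowhere zero on the set. *)

(* Defs.v *)
From HB Require Import structures.
From mathcomp Require Import all_boot all_order all_algebra.
From mathcomp Require Import complex ring.
From mathcomp Require Import all_classical all_reals all_analysis.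

Set Implicit Arguments.
Unset Strict Implicit.
Unset Printing Implicit Defensive.

Import Order.TTheory GRing.Theory Num.Theory.
Import numFieldNormedType.Exports.

Local Open Scope ring_scope.
Local Open Scope complex_scope.
Local Open Scope classical_set_scope.

(* The complex numbers over the real field F, packed as a numFieldType: this is
   the key on which the topology and the normed space structure given by the
   complex modulus are inferred, so that [derivable f x 1] and [derive1 f] below are
   complex differentiability and the complex derivative. *)
Definition Cplx (F : realType) : numFieldType := F[i].

Definition holomorphic_on (F : realType) (U : set (Cplx F))
    (f : Cplx F -> Cplx F) : Prop :=
  forall x, U x -> derivable f x 1.

Definition satisfies_S (F : realType) (k : Cplx F) (U : set (Cplx F))
    (p q r : Cplx F -> Cplx F) : Prop :=
  [/\ holomorphic_on U p, holomorphic_on U q, holomorphic_on U r &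
      forall x, U x ->
        [/\ derive1 p x = 1 / 6 * (p x ^+ 2 - q x),
            derive1 q x = 2 / 3 * (p x * q x - r x) &
            derive1 r x = p x * r x + k ^+ 2 / (36 - k ^+ 2) * q x ^+ 2]].

Fact S_coef_three_halves (F : realType) :
  (3 / 2) ^+ 2 / (36 - (3 / 2) ^+ 2) = 1 / 15 :> Cplx F.
Proof.
have -> : 36 - (3 / 2) ^+ 2 = 135 / 4 :> Cplx F by field.
by field.
Qed.

Fact S_coef_three (F : realType) : 3 ^+ 2 / (36 - 3 ^+ 2) = 1 / 3 :> Cplx F.
Proof.
have -> : 36 - 3 ^+ 2 = 27 :> Cplx F by ring.
by field.
Qed.

(* [derive1n] is a total operator, hence the explicit requirement that y be three
   times complex differentiable on U. *)
Definition generalised_chazy (F : realType) (k : Cplx F) (U : set (Cplx F))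
    (y : Cplx F -> Cplx F) : Prop :=
  (forall n : nat, (n < 3)%N -> holomorphic_on U (derive1n n y)) /\
  (forall x, U x ->
     derive1n 3 y x - 2 * y x * derive1n 2 y x + 3 * derive1 y x ^+ 2
       - 4 / (36 - k ^+ 2) * (6 * derive1 y x - y x ^+ 2) ^+ 2 = 0).

(* Main.v *)
Require Import Defs.
From HB Require Import structures.
From mathcomp Require Import all_boot all_order all_algebra.
From mathcomp Require Import complex ring.
From mathcomp Require Import all_classical all_reals all_analysis.

Set Implicit Arguments.
Unset Strict Implicit.
Unset Printing Implicit Defensive.

Import Order.TTheory GRing.Theory Num.Theory.
Import numFieldNormedType.Exports.

Local Open Scope ring_scope.
Local Open Scope classical_set_scope.

(* Part (i) is differentiation: since [Q = -(5/3) w^2], everything is a rational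
   function of [P], [R], [w], and Chazy's equation follows from any [S_k] by
   eliminating [q] and [r].
   In part (ii), put [u = 4z - 3q] and [D = q^3 + 3r^2]; the cubic says that
   [D = z u^2], and its derivative in [z] is [3(4z - q)u].  Where [u != 0],
   implicit differentiation gives [z'].  If [u] vanishes at [x], so does [D]; as
   [S_3] implies [D' = 2pD], [D] vanishes along a real ray issued from [x], hence
   so does [u] because [z x != 0].  Thus [u' x = 0], that is
   [z' x = (3/4) q' x], which is the same value of [z']. *)

(* A copy of [is_derive] that is not a type class: the derivative can then be
   left as an existential variable to be computed by the tactic [diff]. *)
Definition has_derivative {K : numFieldType} (f : K -> K) (x a : K) : Prop :=
  is_derive x 1 f a.

(** * Rules of differentiation with explicit values *)

Section HasDerivative.
Context {K : numFieldType}.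
Implicit Types (f g : K -> K) (x a b c : K).

Lemma has_derivativeP f x a :
  has_derivative f x a <-> derivable f x 1 /\ derive1 f x = a.
Proof. by rewrite derive1E; split=> -[]. Qed.

Lemma has_derivative_eq f x a b :
  has_derivative f x a -> a = b -> has_derivative f x b.
Proof. by move=> ? <-. Qed.

Lemma has_derivative_unique f x a b :
  has_derivative f x a -> has_derivative f x b -> a = b.
Proof. by move=> [_ <-] [_ <-]. Qed.

Lemma near_eq_has_derivative f g x a : (\near x, f x = g x) ->
  has_derivative f x a -> has_derivative g x a.
Proof. exact: near_eq_is_derive. Qed.

Lemma has_derivative_cst x c : has_derivative (fun=> c) x 0.
Proof. exact: is_derive_cst. Qed.

Lemma has_derivativeD f g x a b : has_derivative f x a ->
  has_derivative g x b -> has_derivative (fun y => f y + g y) x (a + b).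
Proof. exact: is_deriveD. Qed.

Lemma has_derivativeN f x a : has_derivative f x a ->
  has_derivative (fun y => - f y) x (- a).
Proof. exact: is_deriveN. Qed.

Lemma has_derivativeM f g x a b : has_derivative f x a ->
  has_derivative g x b ->
  has_derivative (fun y => f y * g y) x (f x * b + g x * a).
Proof. exact: is_deriveM. Qed.

Lemma has_derivativeX n f x a : has_derivative f x a ->
  has_derivative (fun y => f y ^+ n) x (n%:R * f x ^+ n.-1 * a).
Proof.
have -> : (fun y => f y ^+ n) = f ^+ n by apply/funext=> y; rewrite fctE.
exact: is_deriveX.
Qed.

Lemma has_derivativeV f x a : f x != 0 -> has_derivative f x a ->
  has_derivative (fun y => (f y)^-1) x (- f x ^- 2 * a).
Proof.
move=> fx0 [df dfE]; split; first exact: derivableV.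
by rewrite deriveV// dfE.
Qed.

Lemma has_derivative_continuous f x a :
  has_derivative f x a -> {for x, continuous f}.
Proof. by case=> /derivable1_diffP/differentiable_continuous. Qed.

End HasDerivative.

(** Constants come first, so that a numeral such as [1 / 6] is not split into a product and an
    inverse. Nonvanishing denominators and the derivatives of the basic functions are sought in the
    context. *)
Ltac diff :=
  lazymatch goal with
  | |- has_derivative (fun=> ?c) _ _ => apply: has_derivative_cst
  | |- has_derivative (fun y => _ + _) _ _ => apply: has_derivativeD; diff
  | |- has_derivative (fun y => - _) _ _ => apply: has_derivativeN; diff
  | |- has_derivative (fun y => _ * _) _ _ => apply: has_derivativeM; diff
  | |- has_derivative (fun y => _ ^+ _) _ _ => apply: has_derivativeX; diff
  | |- has_derivative (fun y => _ ^-1) _ _ =>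
      apply: has_derivativeV; [rewrite ?mulf_neq0 ?pnatr_eq0//|diff]
  | |- _ => eassumption
  end.

(** * Restriction to real rays, and uniqueness for a linear equation *)

Section Ray.
Context {F : realType}.
Implicit Types (f g : Cplx F -> Cplx F) (x y a : Cplx F) (t e d s : F).

Local Notation "t %:C" := (real_complex F t : Cplx F).

(** The radius of a ball is an element of [Cplx F]; being positive, it is real. *)
Lemma nbhs_real_ball (P : set (Cplx F)) x : nbhs x P ->
  exists2 d, 0 < d & forall y, `|x - y| < d%:C -> P y.
Proof.
move=> /nbhs_ballP[d /= d0 dP].
have dE : d = (complex.Re d)%:C by apply/esym/RRe_real/gtr0_real.
exists (complex.Re d); first by rewrite -ltcR -dE.
by move=> y; rewrite -dE => /dP.
Qed.

Lemma ReB y1 y2 : complex.Re (y1 - y2) = complex.Re y1 - complex.Re y2.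
Proof. exact: raddfB. Qed.

Lemma real_complexD s t : (s + t)%:C = s%:C + t%:C.
Proof. exact: raddfD. Qed.

Lemma real_complexV s : (s^-1)%:C = (s%:C)^-1.
Proof. exact: fmorphV. Qed.

Lemma Re_realM s y : complex.Re (s%:C * y) = s * complex.Re y.
Proof. by case: y => y1 y2 /=; rewrite mul0r subr0. Qed.

Lemma norm_real_complex s : `|s%:C| = `|s|%:C.
Proof. by rewrite normc_def /= expr0n/= addr0 sqrtr_sqr. Qed.

Lemma has_derivative_along f y a e : has_derivative f y a -> 0 < e ->
  exists2 d, 0 < d & forall s, `|s| < d -> s != 0 ->
    `|a - (s%:C)^-1 * (f (s%:C + y) - f y)| < e%:C.
Proof.
move=> [df <-] e0.
have /cvgrPdist_lt /(_ e%:C) := df.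
rewrite ltcR => /(_ e0) /nbhs_real_ball[d d0 H].
exists d => // s sd s0.
have := H s%:C.
rewrite sub0r normrN norm_real_complex ltcR (inj_eq (@complexI _)) => /(_ sd s0).
by rewrite /= [s%:C *: 1]mulr1.
Qed.

(** Passage from complex to real differentiability: since $|\mathrm{Re}\, y| \le |y|$, the real
    parts of the difference quotients with real increments converge to $\mathrm{Re}\, a$. *)
Lemma is_derive_Re_along f x a t : has_derivative f (t%:C + x) a ->
  is_derive t 1 (fun t => complex.Re (f (t%:C + x))) (complex.Re a).
Proof.
move=> fa.
suff H : (fun h => h^-1 *:
    (((fun t => complex.Re (f (t%:C + x))) \o shift t) (h *: 1)
    - complex.Re (f (t%:C + x)))) @ 0^' --> complex.Re a.
  split; first by apply/cvg_ex; exists (complex.Re a).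
  exact: cvg_lim H.
apply/cvgrPdist_lt => e e0.
have [d d0 fd] := has_derivative_along fa e0.
apply/nbhs_ballP; exists d => // s.
rewrite /= /ball/= sub0r normrN => sd s0.
rewrite -ltcR; apply: le_lt_trans (fd s sd s0).
apply: le_trans (normc_ge_Re _).
by rewrite ReB -real_complexV Re_realM ReB lecR [s *: 1]mulr1 addrA -real_complexD.
Qed.

(** If [a] were nonzero, a small positive increment would give a difference quotient at distance
    less than $|a|$ from [a]; but this quotient is 0. *)
Lemma has_derivative_ray0 f x a d : has_derivative f x a -> 0 < d ->
  (forall t, 0 <= t < d -> f (t%:C + x) = 0) -> a = 0.
Proof.
move=> fa d0 f0; apply/eqP/negPn/negP => an0.
have na0 : 0 < complex.Re `|a|.
  by rewrite -ltcR RRe_real ?normr_real// normr_gt0.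
have [d' d'0 /(_ (Num.min d d' / 2))] := has_derivative_along fa na0.
have m0 : 0 < Num.min d d' by rewrite lt_min d0.
rewrite gtr0_norm ?divr_gt0// gt_eqF ?divr_gt0//.
have m2 : Num.min d d' / 2 < Num.min d d'.
  by rewrite ltr_pdivrMr// ltr_pMr// ltr1n.
have fx : f x = 0 by have := f0 0; rewrite add0r lexx => ->.
rewrite f0; last by rewrite divr_ge0 1?ltW//= (lt_le_trans m2)// ge_min lexx.
rewrite fx subrr mulr0 subr0 RRe_real ?normr_real// ltxx.
move=> H; suff : false by []. apply: H => //.
by rewrite (lt_le_trans m2)// ge_min lexx orbT.
Qed.

(** Uniqueness for $f' = g f$ with zero initial value. Along a real ray it reduces to a real
    differential inequality for $|f|^2$. *)
Lemma linear_ode_ray0 f g x U : open U -> U x -> {for x, continuous g} ->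
  (forall y, U y -> has_derivative f y (g y * f y)) -> f x = 0 ->
  exists2 d, 0 < d & forall t, 0 <= t < d -> f (t%:C + x) = 0.
Proof.
move=> oU Ux gx df fx0.
(* The margin 1 lets continuity of [g] at [x] bound its real part by [K] nearby. *)
pose K := complex.Re (g x) + 1.
have : \forall y \near x, U y /\ complex.Re (g y) <= K.
  near=> y; split; first by near: y; exact: open_nbhs_nbhs.
  rewrite -lerBlDl -lecR -ReB.
  apply: le_trans (_ : `|g y - g x| <= _).
    apply: le_trans (normc_ge_Re _); rewrite lecR; exact: ler_norm.
  rewrite distrC; near: y.
  by have /cvgrPdist_le := gx; apply.
move=> /nbhs_real_ball[d d0 dP].
have {}dP t : 0 <= t < d -> U (t%:C + x) /\ complex.Re (g (t%:C + x)) <= K.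
  move=> /andP[t0 td]; apply: dP.
  by rewrite opprD addrCA subrr addr0 normrN norm_real_complex ltcR ger0_norm.
exists d => // t0 /andP[t00 t0d].
(* Gronwall: [|f|^2 = u^2 + v^2] has derivative [2 Re(g) |f|^2], so that [h] is
   nonincreasing on the ray. *)
pose u t := complex.Re (f (t%:C + x)).
(* This is the imaginary part of [f], written as a real part so that [is_derive_Re_along] applies to
   it. *)
pose v t := complex.Re (- 'i%C * f (t%:C + x)).
pose h t := (u t ^+ 2 + v t ^+ 2) * expR (- (2 * K) * t).
have hd t : 0 <= t < d -> has_derivative h t
    (2 * (complex.Re (g (t%:C + x)) - K) * h t).
  move=> /dP[Uy _].
  have fy := df _ Uy.
  have du : has_derivative u t (complex.Re (g (t%:C + x) * f (t%:C + x))).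
    exact: is_derive_Re_along.
  have dv : has_derivative v t
      (complex.Re (- 'i%C * (g (t%:C + x) * f (t%:C + x)))).
    apply: (is_derive_Re_along (f := fun y => - 'i%C * f y)).
    by apply: has_derivative_eq; [diff|rewrite /= mulr0 addr0].
  have dl : has_derivative (fun t => - (2 * K) * t) t (- (2 * K)).
    have di : has_derivative id t 1 by exact: is_derive_id.
    by apply: has_derivative_eq; [diff|rewrite /= mulr0 addr0 mulr1].
  have de : has_derivative (fun t => expR (- (2 * K) * t)) t
      (expR (- (2 * K) * t) * - (2 * K)).
    exact: (@is_derive1_comp _ expR _ _ _ _ (is_derive_expR _) dl).
  rewrite /h; apply: has_derivative_eq; [diff|].
  rewrite /h /u /v /=; move: (expR _) (f _) (g _) => E [f1 f2] [g1 g2] /=.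
  by ring.
have h0 t : 0 <= h t by rewrite mulr_ge0 ?addr_ge0 ?sqr_ge0 ?expR_ge0.
have ht0 : h t0 <= h 0.
  have sub t : t \in `[0, t0]%R -> 0 <= t < d.
    by rewrite in_itv/= => /andP[-> /le_lt_trans->].
  have subo t : t \in `]0, t0[%R -> 0 <= t < d.
    by move=> tI; apply/sub/subset_itv_oo_cc.
  apply: (@ler0_derive1_le_cc _ h 0 t0).
  - by move=> t /subo/hd[].
  - move=> t /subo tI; have /has_derivativeP[_ ->] := hd t tI.
    rewrite mulr_le0_ge0// mulr_ge0_le0// subr_le0.
    by have [] := dP t tI.
  - by apply: derivable_within_continuous => t /sub/hd[].
  - by rewrite in_itv/= lexx t00.
  - by rewrite in_itv/= lexx.
  - exact: t00.
(* [h] is nonnegative and at most [h 0], which is 0; the exponential being positive, both [u] and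
   [v] vanish at [t0]. *)
have : h t0 = 0.
  apply/eqP; rewrite eq_le h0 andbT (le_trans ht0)//.
  by rewrite /h /u /v add0r fx0 mulr0 /= expr0n/= addr0 mul0r.
move=> /eqP; rewrite mulf_eq0 (gt_eqF (expR_gt0 _)) orbF.
rewrite paddr_eq0 ?sqr_ge0// !sqrf_eq0 /u /v.
case: (f _) => f1 f2 /=; rewrite oppr0 mul0r sub0r mulN1r opprK.
by move=> /andP[/eqP-> /eqP->].
Unshelve. all: by end_near. Qed.

End Ray.

(** * The systems $S_k$, the triples of part (i) and Chazy's equation *)

Section Systems.
Context {F : realType}.
Implicit Types (U : set (Cplx F)) (x k : Cplx F)
  (p q r w z : Cplx F -> Cplx F).

Lemma satisfies_SP k U p q r : satisfies_S k U p q r <->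
  forall x, U x -> [/\ has_derivative p x (1 / 6 * (p x ^+ 2 - q x)),
     has_derivative q x (2 / 3 * (p x * q x - r x)) &
     has_derivative r x (p x * r x + k ^+ 2 / (36 - k ^+ 2) * q x ^+ 2)].
Proof.
split=> [[hp hq hr h] x Ux|h].
  have [? ? ?] := h x Ux.
  by split; apply/has_derivativeP; split=> //; [exact: hp|exact: hq|exact: hr].
by split=> x /h[/has_derivativeP[? ?] /has_derivativeP[? ?] /has_derivativeP[]].
Qed.

(** Differentiating $w^2 = c q$ on both sides gives $2 w w' = c q'$, and [w x] can be cancelled. *)
Lemma has_derivative_sqrt (c a : Cplx F) U q w x : open U -> U x ->
  holomorphic_on U w -> (forall y, U y -> w y ^+ 2 = c * q y) -> w x != 0 ->
  has_derivative q x a -> has_derivative w x (c * a / (2 * w x)).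
Proof.
move=> oU Ux hw wq wx0 qa.
have wb : has_derivative w x (derive1 w x).
  by apply/has_derivativeP; split=> //; exact: hw.
apply: (has_derivative_eq wb).
have e1 : has_derivative (fun y => w y ^+ 2) x (2 * w x * derive1 w x).
  exact: has_derivativeX.
have e2 : has_derivative (fun y => w y ^+ 2) x (c * a).
  apply: (near_eq_has_derivative (f := fun y => c * q y)).
    by apply: filterS (open_nbhs_nbhs (conj oU Ux)) => y /wq ->.
  by apply: has_derivative_eq; [diff | rewrite /=; ring].
by rewrite -(has_derivative_unique e1 e2); field.
Qed.

(** Stated for an arbitrary branch [w], so that it yields both triples: the opposite branch
    exchanges [Z] and [Zbar]. *)
Lemma satisfies_S32_conj U P Q R w : open U ->
  satisfies_S (3 / 2) U P Q R ->
  (forall x, U x -> Q x != 0) ->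
  holomorphic_on U w ->
  (forall x, U x -> w x ^+ 2 = - (3 / 5) * Q x) ->
  let Z := fun x => 3 * R x / (2 * Q x) + 1 / 2 * w x in
  let Zbar := fun x => 3 * R x / (2 * Q x) - 1 / 2 * w x in
  satisfies_S (3 / 2) U (fun x => P x + Z x) (fun x => - (5 / 3) * Zbar x ^+ 2)
    (fun x => 5 / 9 * Zbar x ^+ 2 * (2 * Z x - Zbar x)).
Proof.
move=> oU /satisfies_SP S Q0 hw wQ Z Zbar; apply/satisfies_SP => x Ux.
have := S x Ux; rewrite S_coef_three_halves => -[hP hQ hR].
have Qx0 := Q0 x Ux.
have wx0 : w x != 0.
  by rewrite -sqrf_eq0 wQ// mulf_neq0// oppr_eq0 mulf_neq0 ?invr_eq0 ?pnatr_eq0.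
have dw := has_derivative_sqrt oU Ux hw wQ wx0 hQ.
(* Eliminating [Q x] leaves rational identities in [P x], [R x] and [w x], with powers of [w x] as
   denominators. *)
have Qx : Q x = - (5 / 3) * w x ^+ 2 by rewrite wQ//; field.
by rewrite /Z /Zbar; split; (apply: has_derivative_eq; [diff|rewrite /= Qx; field]).
Qed.

Lemma satisfies_S3_of_S32 U P Q R : satisfies_S (3 / 2) U P Q R ->
  (forall x, U x -> Q x != 0) ->
  satisfies_S 3 U (fun x => P x + R x / Q x)
    (fun x => 3 / 5 * Q x - 3 * (R x ^+ 2 / Q x ^+ 2))
    (fun x => 9 / 5 * R x + 3 * (R x ^+ 3 / Q x ^+ 3)).
Proof.
move=> /satisfies_SP S Q0; apply/satisfies_SP => x Ux.
have := S x Ux; rewrite S_coef_three_halves S_coef_three => -[hP hQ hR].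
have Qx0 := Q0 x Ux.
have Qn0 n : Q x ^+ n != 0 by rewrite expf_neq0.
by split; (apply: has_derivative_eq; [diff|rewrite /=; field]).
Qed.

(** The system expresses $p'$, $p''$, $p'''$ as polynomials in $p, q, r$. As $6p' - p^2 = -q$, the
    last term of Chazy's equation is a multiple of $q^2$ and cancels the one brought in by $r'$. *)
Lemma satisfies_S_chazy k U p q r : open U -> 36 - k ^+ 2 != 0 ->
  satisfies_S k U p q r -> generalised_chazy k U p.
Proof.
move=> oU k0 /satisfies_SP S.
have d1 x : U x -> has_derivative p x (1 / 6 * (p x ^+ 2 - q x)).
  by case/S.
have d2 x : U x -> has_derivative (derive1n 1 p) x
    (1 / 3 * p x * (1 / 6 * (p x ^+ 2 - q x)) - 1 / 9 * (p x * q x - r x)).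
  move=> Ux; have [hp hq hr] := S x Ux.
  (* The formula for $p'$ holds on the open set [U], hence near [x], and can be differentiated
     again. *)
  apply: (near_eq_has_derivative (f := fun y => 1 / 6 * (p y ^+ 2 - q y))).
    apply: filterS (open_nbhs_nbhs (conj oU Ux)) => y /d1.
    by case/has_derivativeP => _ <-.
  by apply: has_derivative_eq; [diff | rewrite /=; field].
have d3 x : U x -> has_derivative (derive1n 2 p) x
    (1 / 3 * (1 / 6 * (p x ^+ 2 - q x)) ^+ 2 + 1 / 3 * p x *
      (1 / 3 * p x * (1 / 6 * (p x ^+ 2 - q x)) - 1 / 9 * (p x * q x - r x))
     - 1 / 9 * (1 / 6 * (p x ^+ 2 - q x) * q x
       + p x * (2 / 3 * (p x * q x - r x))
       - (p x * r x + k ^+ 2 / (36 - k ^+ 2) * q x ^+ 2))).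
  move=> Ux; have [hp hq hr] := S x Ux.
  apply: (near_eq_has_derivative (f := fun y =>
    1 / 3 * p y * (1 / 6 * (p y ^+ 2 - q y)) - 1 / 9 * (p y * q y - r y))).
    apply: filterS (open_nbhs_nbhs (conj oU Ux)) => y /d2.
    by case/has_derivativeP => _ <-.
  by apply: has_derivative_eq; [diff | rewrite /=; field].
split=> [[|[|[|//]]] _ x Ux|x Ux].
- by case: (d1 x Ux).
- by case: (d2 x Ux).
- by case: (d3 x Ux).
have /has_derivativeP[_ e1] := d1 x Ux.
have /has_derivativeP[_ e2] := d2 x Ux.
have /has_derivativeP[_ e3] := d3 x Ux.
rewrite [derive1n 3 p x]e3 [derive1n 2 p x]e2 e1.
by field.
Qed.

(** * Part (ii): the derivative of a root of the cubic, and the converse transformation *)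

Lemma cubic_root_has_derivative U p q r z x : open U -> satisfies_S 3 U p q r ->
  holomorphic_on U z ->
  (forall y, U y -> 16 * z y ^+ 3 - 24 * q y * z y ^+ 2 + 9 * q y ^+ 2 * z y
     - q y ^+ 3 - 3 * r y ^+ 2 = 0) ->
  U x -> 4 * z x - q x != 0 ->
  has_derivative z x (2 / 3 * z x * (p x - 2 * r x / (4 * z x - q x))).
Proof.
move=> oU /satisfies_SP S hz cubic Ux s0.
have {}S y : U y -> [/\ has_derivative p y (1 / 6 * (p y ^+ 2 - q y)),
    has_derivative q y (2 / 3 * (p y * q y - r y)) &
    has_derivative r y (p y * r y + 1 / 3 * q y ^+ 2)].
  by rewrite -S_coef_three; apply: S.
have dz : has_derivative z x (derive1 z x).
  by apply/has_derivativeP; split=> //; exact: hz.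
(* The target value of [b] is the second equation of $S_{3/2}$ for the triple of part (ii), solved
   for $z'$. *)
apply: (has_derivative_eq dz); set b := derive1 z x in dz *.
have [hp hq hr] := S x Ux.
(* Since $4z - q \ne 0$, the root [z x] is simple exactly when $4z - 3q \ne 0$; that case comes
   first. *)
have [u0|u0] := eqVneq (4 * z x - 3 * q x) 0; last first.
  have d0 : has_derivative (fun y => 16 * z y ^+ 3 - 24 * q y * z y ^+ 2
      + 9 * q y ^+ 2 * z y - q y ^+ 3 - 3 * r y ^+ 2) x 0.
    apply: near_eq_has_derivative (has_derivative_cst x 0).
    by apply: filterS (open_nbhs_nbhs (conj oU Ux)) => y /cubic ->.
  have d1 : has_derivative (fun y => 16 * z y ^+ 3 - 24 * q y * z y ^+ 2
      + 9 * q y ^+ 2 * z y - q y ^+ 3 - 3 * r y ^+ 2) x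
      (3 * (4 * z x - q x) * ((4 * z x - 3 * q x) * b
         - (2 * z x - q x) * (2 / 3 * (p x * q x - r x)))
       - 6 * r x * (p x * r x + 1 / 3 * q x ^+ 2)).
    by apply: has_derivative_eq; [diff|rewrite /=; field].
  have e0 := has_derivative_unique d0 d1.
  have n0 : 3 * (4 * z x - q x) * (4 * z x - 3 * q x) != 0.
    by rewrite !mulf_neq0 ?pnatr_eq0.
  apply/eqP; rewrite -subr_eq0; move: n0; apply: contraNT => e.
  rewrite -(mulIr_eq0 _ (mulIf e)); apply/eqP.
  have c0 := cubic x Ux.
  (* Let $C$ be the left side of the cubic and $t$ the target value. Then $3(4z-q)(4z-3q)(b-t) = C'
     - 2pC$, where both $C$ and $C'$ are 0 at [x]. *)
  transitivity (0 - 2 * p x * 0 : Cplx F); last by ring.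
  by rewrite {1}e0 -c0; field.
pose D y := q y ^+ 3 + 3 * r y ^+ 2.
have DE y : U y -> D y = z y * (4 * z y - 3 * q y) ^+ 2.
  by move=> /cubic c0; rewrite -[RHS]subr0 -c0 /D; ring.
have dD y : U y -> has_derivative D y (2 * p y * D y).
  move=> /S[hpy hqy hry].
  by rewrite /D; apply: has_derivative_eq; [diff|rewrite /=; field].
have cz : {for x, continuous z}.
  exact: has_derivative_continuous dz.
have cp : {for x, continuous (fun y => 2 * p y)}.
  by apply: has_derivative_continuous; diff.
have Dx0 : D x = 0 by rewrite DE// u0 expr0n/= mulr0.
have [d1 d10 D0] := linear_ode_ray0 oU Ux cp dD Dx0.
(* If [z x] were 0, then $4z = 3q$ would give $q = 0$, against $4z - q \ne 0$. *)
have zx0 : z x != 0.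
  apply: contra s0 => /eqP zx0; move: u0.
  rewrite zx0 mulr0 !sub0r => /eqP.
  by rewrite !oppr_eq0 mulf_eq0 pnatr_eq0.
have : \forall y \near x, U y /\ z y != 0.
  near=> y; split; first by near: y; exact: open_nbhs_nbhs.
  by near: y; exact: cvgr_neq0 cz zx0.
move=> /nbhs_real_ball[d2 d20 z0].
have ray t : 0 <= t < Num.min d1 d2 ->
    4 * z (real_complex F t + x) - 3 * q (real_complex F t + x) = 0.
  move=> /andP[t0]; rewrite lt_min => /andP[td1 td2].
  have /z0[Uy zy0] : `|x - (real_complex F t + x)| < real_complex F d2.
    by rewrite opprD addrCA subrr addr0 normrN norm_real_complex ltcR ger0_norm.
  have := D0 t; rewrite t0 td1 DE// => /(_ isT)/eqP.
  by rewrite mulf_eq0 (negPf zy0) /= sqrf_eq0 => /eqP.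
have du : has_derivative (fun y => 4 * z y - 3 * q y) x
    (4 * b - 3 * (2 / 3 * (p x * q x - r x))).
  by apply: has_derivative_eq; [diff|rewrite /=; ring].
have m0 : 0 < Num.min d1 d2 by rewrite lt_min d10.
have := has_derivative_ray0 du m0 ray => e.
(* At the double root $z = \frac34 q$ one has $4z - q = 2q$, and both values of $z'$ reduce to
   $\frac12(pq - r)$. *)
have zE : z x = 3 / 4 * q x.
  rewrite -[z x](mulKf (_ : 4 != 0)) ?pnatr_eq0//.
  by rewrite -[4 * z x](subrK (3 * q x)) u0; field.
have q0 : q x != 0 by apply: contra zx0 => /eqP qx; rewrite zE qx mulr0.
have bE : b = 1 / 2 * (p x * q x - r x).
  by rewrite -[b](mulKf (_ : 4 != 0)) ?pnatr_eq0// -[4 * b]subr0 -e; field.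
have -> : 4 * z x - q x = 2 * q x by rewrite zE; field.
by rewrite bE zE; field.
Unshelve. all: by end_near. Qed.

(** Once $z'$ is known, each equation is a rational identity modulo the cubic. *)
Lemma satisfies_S32_of_S3 U p0 q0 r0 z : open U -> satisfies_S 3 U p0 q0 r0 ->
  holomorphic_on U z ->
  (forall x, U x ->
     16 * z x ^+ 3 - 24 * q0 x * z x ^+ 2 + 9 * q0 x ^+ 2 * z x
       - q0 x ^+ 3 - 3 * r0 x ^+ 2 = 0) ->
  (forall x, U x -> 4 * z x - q0 x != 0) ->
  satisfies_S (3 / 2) U (fun x => p0 x - r0 x / (4 * z x - q0 x))
    (fun x => 5 / 3 * z x) (fun x => 5 / 3 * (r0 x * z x / (4 * z x - q0 x))).
Proof.
move=> oU S hz cubic s0; apply/satisfies_SP => x Ux.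
have dz := cubic_root_has_derivative oU S hz cubic Ux (s0 x Ux).
have := (satisfies_SP _ _ _ _ _).1 S x Ux.
rewrite S_coef_three S_coef_three_halves => -[hp hq hr].
have sx0 := s0 x Ux.
set s := 4 * z x - q0 x in dz.
have s_neq0 : s != 0 by [].
(* In terms of [s = 4z - q], the cubic is linear in [q]. *)
have qE : q0 x = s / 3 - 4 * r0 x ^+ 2 / s ^+ 2.
  have c : s ^+ 2 * (s - 3 * q0 x) = 12 * r0 x ^+ 2.
    by apply/eqP; rewrite -subr_eq0 -(mulr0 4) -(cubic x Ux) /s; apply/eqP; ring.
  have -> : 4 * r0 x ^+ 2 = s ^+ 2 * (s - 3 * q0 x) / 3 by rewrite c; field.
  by field.
have zE : z x = (s + q0 x) / 4 by rewrite /s; field.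
by split; (apply: has_derivative_eq; [diff|rewrite /= -/s zE qE; field]).
Qed.

End Systems.

(** * Assembly of the two parts *)

Theorem theorem3p1 (F : realType) (U : set (Cplx F)) :
  open U -> connected U ->
  (forall P Q R w : Cplx F -> Cplx F,
     satisfies_S (3 / 2) U P Q R ->
     (forall x, U x -> Q x != 0) ->
     (* w is the fixed branch of the square root of - (3/5) Q *)
     holomorphic_on U w ->
     (forall x, U x -> w x ^+ 2 = - (3 / 5) * Q x) ->
     let Z := fun x => 3 * R x / (2 * Q x) + 1 / 2 * w x in
     let Zbar := fun x => 3 * R x / (2 * Q x) - 1 / 2 * w x in
     let p1 := P in
     let p2 := fun x => P x + Z x in
     let q2 := fun x => - (5 / 3) * Zbar x ^+ 2 in
     let r2 := fun x => 5 / 9 * Zbar x ^+ 2 * (2 * Z x - Zbar x) in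
     let p3 := fun x => P x + Zbar x in
     let q3 := fun x => - (5 / 3) * Z x ^+ 2 in
     let r3 := fun x => 5 / 9 * Z x ^+ 2 * (2 * Zbar x - Z x) in
     let p0 := fun x => P x + R x / Q x in
     let q0 := fun x => 3 / 5 * Q x - 3 * (R x ^+ 2 / Q x ^+ 2) in
     let r0 := fun x => 9 / 5 * R x + 3 * (R x ^+ 3 / Q x ^+ 3) in
     [/\ satisfies_S (3 / 2) U p2 q2 r2,
         satisfies_S (3 / 2) U p3 q3 r3,
         forall x, U x -> p0 x = 1 / 3 * (p1 x + p2 x + p3 x),
         satisfies_S 3 U p0 q0 r0 &
         generalised_chazy 3 U p0])
  /\
  (forall p0 q0 r0 z : Cplx F -> Cplx F,
     satisfies_S 3 U p0 q0 r0 ->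
     holomorphic_on U z ->
     (forall x, U x ->
        16 * z x ^+ 3 - 24 * q0 x * z x ^+ 2 + 9 * q0 x ^+ 2 * z x
          - q0 x ^+ 3 - 3 * r0 x ^+ 2 = 0) ->
     (forall x, U x -> 4 * z x - q0 x != 0) ->
     let P := fun x => p0 x - r0 x / (4 * z x - q0 x) in
     let Q := fun x => 5 / 3 * z x in
     let R := fun x => 5 / 3 * (r0 x * z x / (4 * z x - q0 x)) in
     satisfies_S (3 / 2) U P Q R).
Proof.
move=> oU _; split; last first.
  by move=> p0 q0 r0 z S hz cubic s0; apply: satisfies_S32_of_S3.
move=> P Q R w S Q0 hw wQ Z Zbar p1 p2 q2 r2 p3 q3 r3 p0 q0 r0.
have S0 : satisfies_S 3 U p0 q0 r0 by apply: satisfies_S3_of_S32.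
have S3_neq0 : 36 - 3 ^+ 2 != 0 :> Cplx F.
  by have -> : 36 - 3 ^+ 2 = 27 :> Cplx F by [ring]; rewrite pnatr_eq0.
split.
- exact: satisfies_S32_conj oU S Q0 hw wQ.
(* The third triple is the second one for the branch $-w$, which exchanges [Z] and [Zbar]. *)
- have hNw : holomorphic_on U (fun x => - w x).
    by move=> x Ux; apply: derivableN; apply: hw.
  have NwQ x : U x -> (- w x) ^+ 2 = - (3 / 5) * Q x.
    by move=> Ux; rewrite sqrrN wQ.
  have ZE : (fun x => 3 * R x / (2 * Q x) - 1 / 2 * - w x) = Z.
    by apply/funext => x; rewrite mulrN opprK.
  have ZbarE : (fun x => 3 * R x / (2 * Q x) + 1 / 2 * - w x) = Zbar.
    by apply/funext => x; rewrite mulrN.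
  rewrite /p3 /q3 /r3 -ZE -ZbarE.
  exact: satisfies_S32_conj oU S Q0 hNw NwQ.
- by move=> x Ux; rewrite /p0 /p1 /p2 /p3 /Z /Zbar; field; exact: Q0.
- exact: S0.
- exact: satisfies_S_chazy oU S3_neq0 S0.
Qed.
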